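(* Every field extension over a perfect field is formally smooth; that is, if $k/F$ is an extension of fields (not necessarily algebraic or finitely generated) with $F$ a perfect field, then the ring map $F\rightarrow k$ is formally smooth.
   Context: All rings are commutative with $1$. A ring map $f:R\rightarrow S$ is formally smooth if for every ring $A$, every ideal $I$ of $A$ with $I^{2}=0$, and all ring maps $h:R\rightarrow A$ and $h':S\rightarrow A/I$ with $\pi h=h'f$ (where $\pi:A\rightarrow A/I$ is the natural map), there is at least one ring map $g:S\rightarrow A$ with $gf=h$ and $\pi g=h'$. (No topology is involved.) *)

(* Defs.v *)
From HB Require Import structures.
From mathcomp Require Import all_boot all_order all_algebra.

Set Implicit Arguments.
Unset Strict Implicit.
Unset Printing Implicit Defensive.

Import GRing.Theory.
Local Open Scope ring_scope.
Local Open Scope quotient_scope.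

(* [idealr] and [{ideal_quot _}] of ring_quotient.v are restricted to proper
   ideals of nonzero rings.  Formal smoothness quantifies over all commutative
   rings (the zero ring included) and all ideals, so both notions are redone
   here over [comPzRingType]; the additive quotient is the library's. *)

HB.mixin Record isMulAbsorbing (R : comPzRingType) (S : R -> bool) := {
  ideal_mull_subproof : forall a, {in S, forall u, a * u \in S}
}.

#[short(type="ideal")]
HB.structure Definition Ideal (R : comPzRingType) :=
  {S of GRing.ZmodClosed R S & isMulAbsorbing R S}.

Section QuotientRing.
Variables (R : comPzRingType) (I : ideal R).

Lemma ideal_mull (a u : R) : u \in I -> a * u \in I.
Proof. exact: ideal_mull_subproof. Qed.

Definition quotient_ring := Quotient.quot I.

HB.instance Definition _ := GRing.Zmodule.on quotient_ring.
HB.instance Definition _ : EqQuotient R (Quotient.equiv I) quotient_ring :=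
  EqQuotient.on quotient_ring.
HB.instance Definition _ :
    isZmodQuotient R (Quotient.equiv I) 0 -%R +%R quotient_ring :=
  ZmodQuotient.on quotient_ring.

Definition quotient_one : quotient_ring := lift_cst quotient_ring 1.
Definition quotient_mul := lift_op2 quotient_ring *%R.

Canonical pi_quotient_one := PiConst quotient_one.

Lemma pi_mul : {morph \pi_quotient_ring : x y / x * y >-> quotient_mul x y}.
Proof.
move=> x y; unlock quotient_mul; apply/eqP; rewrite piE Quotient.equivE.
rewrite -[_ * _](addrNK (x * repr (\pi_quotient_ring y))) -mulrBr.
rewrite -addrA -mulrBl rpredD //.
  by rewrite ideal_mull // Quotient.idealrDE opprK reprK.
by rewrite mulrC ideal_mull // Quotient.idealrDE opprK reprK.
Qed.
Canonical pi_quotient_mul := PiMorph2 pi_mul.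

Lemma quotient_mulA : associative quotient_mul.
Proof. by move=> x y z; rewrite -[x]reprK -[y]reprK -[z]reprK !piE mulrA. Qed.

Lemma quotient_mulC : commutative quotient_mul.
Proof. by move=> x y; rewrite -[x]reprK -[y]reprK !piE mulrC. Qed.

Lemma quotient_mul1 : left_id quotient_one quotient_mul.
Proof. by move=> x; rewrite -[x]reprK !piE mul1r. Qed.

Lemma quotient_mulDl : left_distributive quotient_mul +%R.
Proof.
move=> x y z; rewrite -[x]reprK -[y]reprK -[z]reprK.
by rewrite !piE mulrDl.
Qed.

HB.instance Definition _ := GRing.Zmodule_isComPzRing.Build quotient_ring
  quotient_mulA quotient_mulC quotient_mul1 quotient_mulDl.

Definition quotient_map : R -> quotient_ring := \pi_quotient_ring.

Lemma quotient_map_is_zmod_morphism : zmod_morphism quotient_map.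
Proof. by move=> x y; rewrite /quotient_map !piE. Qed.

Lemma quotient_map_is_monoid_morphism : monoid_morphism quotient_map.
Proof. by split=> [|x y]; rewrite /quotient_map !piE. Qed.

HB.instance Definition _ := GRing.isZmodMorphism.Build R quotient_ring
  quotient_map quotient_map_is_zmod_morphism.
HB.instance Definition _ := GRing.isMonoidMorphism.Build R quotient_ring
  quotient_map quotient_map_is_monoid_morphism.

Lemma quotient_map_eq0 (x : R) : (quotient_map x == 0) = (x \in I).
Proof. by rewrite /quotient_map -[0](rmorph0 quotient_map) -Quotient.idealrBE subr0. Qed.

Lemma quotient_map_surj (y : quotient_ring) : exists x, quotient_map x = y.
Proof. by exists (repr y); rewrite /quotient_map reprK. Qed.

End QuotientRing.

Definition formally_smooth (R S : comPzRingType) (f : {rmorphism R -> S}) :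
    Prop :=
  forall (A : comPzRingType) (I : ideal A),
    {in I &, forall x y, x * y = 0} ->
  forall (h : {rmorphism R -> A}) (h' : {rmorphism S -> quotient_ring I}),
    quotient_map I \o h =1 h' \o f ->
  exists g : {rmorphism S -> A},
    g \o f =1 h /\ quotient_map I \o g =1 h'.

Definition perfect_field (F : fieldType) : Prop :=
  [pchar F] =i pred0 \/
  exists2 p : nat, p \in [pchar F] & forall x : F, exists y : F, y ^+ p = x.

(* Main.v *)
From HB Require Import structures.
Require Import Defs.
From mathcomp Require Import all_boot all_order all_algebra.
From mathcomp Require Import boolp classical_sets ring.

(** The lift of [h' : k -> A/I] is built by Zorn's lemma on partial lifts,
    that is, on ring maps [g : K -> A] with [K] a subring of [k] such that
    [pi g = h'].  A partial lift is handled through its graph, a subring of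
    [k * A]; extension of partial lifts is then inclusion of sets.

    A maximal partial lift is defined on a subfield: an element of [A] whose
    image in [A/I] is the image of a nonzero element of [k] is a unit, because
    [I] is nilpotent, so a partial lift extends to the fractions
    ([maximal_lift_graphV]).  If [K] is a field and [x] is in [k], extending
    [g] to [K[x]] means finding [a] over [h' x] that is a root of [g m], for
    [m] a polynomial of minimal degree over [K] that vanishes at [x] (there is
    no condition if [x] is transcendental).  When [m'(x) <> 0], one Newton step
    corrects an arbitrary lift of [h' x], since [I^2 = 0].  The difficulty is
    the inseparable case, in which [k] may well be inseparable over [K].

    The difficulty disappears if [K] contains the [p]-th powers of [k] and [g]
    is there the canonical lift: in characteristic [p], the [p]-th power of a
    lift [a] of [h' x] depends only on [x], because
    [(a + i)^p = a^p + i^p = a^p] for [i] in [I].  So [x^p |-> a^p] is a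
    partial lift on [k^p] ([frobenius_lift_graph]).  For an inseparable [x] the
    polynomial [m] has degree at least [p] and divides ['X^p - x^p], hence is
    associate to it, and every lift [a] of [h' x] is a root of its image
    ['X^p - a^p] ([lift_root_of_minimal]).

    Perfection of [F] is used to start: in characteristic [p] it gives
    [F = F^p], which lies in [k^p], so that the canonical lift on [k^p] already
    extends [h]; in characteristic [0] one starts from [h] on the image of [F]
    and no inseparable [x] occurs ([lift_of_perfect]). *)

Set Implicit Arguments.
Unset Strict Implicit.
Unset Printing Implicit Defensive.

Import GRing.Theory.
Local Open Scope classical_set_scope.
Local Open Scope ring_scope.

(** * Square-zero extensions *)

Lemma horner_add_sqr0 (A : comNzRingType) (P : {poly A}) (a e : A) :
  e * e = 0 -> P.[a + e] = P.[a] + P^`().[a] * e.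
Proof.
move=> ee0; elim/poly_ind: P => [|P c IH].
  by rewrite deriv0 !horner0 mul0r addr0.
rewrite derivMXaddC !hornerMXaddC hornerD hornerMX IH.
have -> : (P.[a] + P^`().[a] * e) * (a + e) + c
  = P.[a] * a + c + (P.[a] + P^`().[a] * a) * e + P^`().[a] * (e * e) by ring.
by rewrite ee0 mulr0 addr0.
Qed.

Section Lifting.

(** [q] plays the role of the projection [A -> A/I].  [A] is a nonzero ring so
    that it has a type of polynomials over it. *)
Variables (k : fieldType) (A : comNzRingType) (B : comPzRingType).
Variables (q : {rmorphism A -> B}) (h : {rmorphism k -> B}).
Hypothesis q_surj : forall y, exists a, q a = y.
Hypothesis ker_sqr0 : forall a b, q a = 0 -> q b = 0 -> a * b = 0.

(** If [c] lifts [x^-1], then [c * a = 1 - i] with [i] in the kernel, and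
    [(1 + i) * c] is inverse to [a]. *)
Lemma lift_inv (x : k) (a : A) : q a = h x -> x != 0 -> exists b, b * a = 1.
Proof.
move=> qa x0; have [c qc] := q_surj (h x^-1).
have qi : q (1 - c * a) = 0.
  by rewrite rmorphB rmorph1 rmorphM qc qa -rmorphM mulVf // rmorph1 subrr.
have := ker_sqr0 qi qi; set i := 1 - c * a => ii.
exists ((1 + i) * c); rewrite -mulrA.
have -> : c * a = 1 - i by rewrite /i opprB addrC subrK.
by rewrite mulrBr mulr1 mulrDl mul1r ii addr0 addrK.
Qed.

(** * Adjoining one element to the domain of a lift *)

Section AdjoinElement.

Variables (L : fieldType) (j : {rmorphism L -> k}) (g : {rmorphism L -> A}).
Hypothesis lift_g : forall l, q (g l) = h (j l).

Lemma horner_lift (f : {poly L}) (x : k) (a : A) :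
  q a = h x -> q (map_poly g f).[a] = h (map_poly j f).[x].
Proof.
move=> qa; elim/poly_ind: f => [|f c IH].
  by rewrite !rmorph0 !horner0 !rmorph0.
rewrite !(rmorphD, rmorphM) /= !map_polyC !map_polyX !hornerMXaddC.
by rewrite !(rmorphD, rmorphM) /= IH qa lift_g.
Qed.

(** Without this, the minimal polynomial ['X^p - x^p] of an inseparable [x]
    could be sent by [g] to a polynomial with no root above [h x]. *)
Hypothesis frob : forall p (y : k) (b : A), p \in [pchar k] -> q b = h y ->
  exists l, j l = y ^+ p /\ g l = b ^+ p.

(** If [m'(x) <> 0], a Newton step turns any lift of [h x] into a root.
    Otherwise [m' = 0] by minimality, so the characteristic is some [p] that
    divides the degree of [m]; as [m] divides ['X^p - x^p], it is associate to
    it, and any lift is a root. *)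
Lemma lift_root_of_minimal (x : k) (m : {poly L}) :
  m != 0 -> root (map_poly j m) x ->
  (forall f : {poly L},
     (size f < size m)%N -> root (map_poly j f) x -> f = 0) ->
  exists2 a, q a = h x & root (map_poly g m) a.
Proof.
move=> m0 mx mmin; have [a qa] := q_surj (h x).
have [m'x|m'x] := boolP (root (map_poly j m^`()) x); last first.
  have qm' : q (map_poly g m^`()).[a] = h (map_poly j m^`()).[x].
    exact: horner_lift.
  have [b bm'] := lift_inv qm' m'x.
  (* the Newton correction: [e = - m(a) / m'(a)] *)
  pose e := - (b * (map_poly g m).[a]).
  have qe : q e = 0.
    rewrite rmorphN rmorphM (horner_lift _ qa) (rootP mx).
    by rewrite rmorph0 mulr0 oppr0.
  exists (a + e); first by rewrite rmorphD qe addr0.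
  rewrite rootE horner_add_sqr0 ?(ker_sqr0 qe qe) // deriv_map /e mulrN mulrA.
  by rewrite [_ * b]mulrC bm' mul1r subrr.
have m'0 : m^`() = 0 by apply: mmin m'x; exact: lt_size_deriv.
have sm : (1 < size m)%N.
  rewrite ltnNge; apply/negP => /size1_polyC mC; move: mx m0.
  by rewrite mC map_polyC rootC fmorph_eq0 polyC_eq0 => /eqP ->; rewrite eqxx.
(* the leading coefficient of [m^`()] is this multiple of that of [m] *)
have n0 : (size m).-1%:R == 0 :> k.
  have := congr1 (fun f : {poly L} => f`_(size m).-2) m'0.
  rewrite coef_deriv coef0 prednK -?subn1 ?subn_gt0 // subn1.
  move/(congr1 j)/eqP; rewrite rmorphMn rmorph0 -mulr_natr mulf_eq0.
  by rewrite fmorph_eq0 -lead_coefE lead_coef_eq0 (negPf m0).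
have [|p pk] := natf0_pchar _ n0; first by rewrite -subn1 subn_gt0.
have p_gt0 : (0 < p)%N by apply/prime_gt0/pcharf_prime/pk.
have [l [jl gl]] := frob pk qa.
have mdvd : m %| 'X^p - l%:P.
  rewrite -[_ %| _]/(_ %% _ == 0); apply/eqP/mmin; first by rewrite ltn_modp.
  have := divp_eq ('X^p - l%:P) m => /(congr1 (map_poly j)).
  rewrite !rmorphB rmorphD rmorphM /= map_polyXn map_polyC /= jl.
  move/(congr1 (horner^~ x)); rewrite !hornerE subrr (rootP mx) mulr0 add0r.
  by move=> E; rewrite rootE -E.
have szm : (size ('X^p - l%:P)%R <= size m)%N.
  rewrite size_XnsubC // -[size m]prednK ?(ltnW sm) // ltnS dvdn_leq //.
    by rewrite -subn1 subn_gt0.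
  by rewrite (dvdn_pcharf pk).
exists a => //.
have : ('X^p - l%:P) %= m.
  rewrite eqp_sym -dvdp_size_eqp // eqn_leq szm andbT dvdp_leq //.
  by rewrite -size_poly_eq0 size_XnsubC.
case/andP=> /dvdpP[r ->] _.
rewrite rootE rmorphM rmorphB /= map_polyXn map_polyC /= gl.
by rewrite !hornerE subrr mulr0.
Qed.

(** In this form the result says that [f(x) |-> (g f)(a)] is well defined on
    [L[x]]; it holds because the minimal polynomial of [x], if there is one,
    divides every such [f]. *)
Lemma lift_adjoin (x : k) :
  exists2 a, q a = h x &
    forall f : {poly L}, root (map_poly j f) x -> root (map_poly g f) a.
Proof.
have [[f0 [f0_neq0 f0x]]|transc] :=
  pselect (exists f : {poly L}, f != 0 /\ root (map_poly j f) x); last first.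
  have [a qa] := q_surj (h x); exists a => // f fx.
  have [->|f0] := eqVneq f 0; first by rewrite rmorph0 root0.
  by case: transc; exists f.
pose P n := `[< exists f : {poly L},
  [/\ size f = n, f != 0 & root (map_poly j f) x] >].
have exP : exists n, P n by exists (size f0); apply/asboolP; exists f0.
case: (ex_minnP exP) => n /asboolP[m [<- m0 mx]] nmin {n}.
have mmin (f : {poly L}) :
    (size f < size m)%N -> root (map_poly j f) x -> f = 0.
  move=> fm fx; case: (eqVneq f 0) => // f_neq0.
  move: fm; rewrite ltnNge nmin //.
  by apply/asboolP; exists f.
have [a qa ma] := lift_root_of_minimal m0 mx mmin.
exists a => // f fx.
have fm : f %% m = 0.
  apply: mmin; first by rewrite ltn_modp.
  have := fx; rewrite {1}(divp_eq f m) rmorphD rmorphM /= !rootE !hornerE.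
  by rewrite (rootP mx) mulr0 add0r.
by rewrite (divp_eq f m) fm addr0 rmorphM /= rootE hornerM (rootP ma) mulr0.
Qed.

End AdjoinElement.
(** * Graphs of partial lifts *)

(** These are the graphs of the ring maps [g] from a subring of [k] to [A]
    such that [q \o g] is the restriction of [h]. *)
Record lift_graph (G : set (k * A)) : Prop := LiftGraph {
  lift_graph1 : G 1;
  lift_graphB : forall u v, G u -> G v -> G (u - v);
  lift_graphM : forall u v, G u -> G v -> G (u * v);
  lift_graph_lifts : forall u, G u -> q u.2 = h u.1;
  lift_graph_functional : forall u, G u -> u.1 = 0 -> u.2 = 0
}.

Lemma lift_graph_eq (G : set (k * A)) u v :
  lift_graph G -> G u -> G v -> u.1 = v.1 -> u.2 = v.2.
Proof.
move=> HG Gu Gv uv; apply/eqP; rewrite -subr_eq0; apply/eqP.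
apply: (lift_graph_functional HG (lift_graphB HG Gu Gv)).
by rewrite /= uv subrr.
Qed.

(** A lift graph closed under inverses is turned into an abstract field with
    two projections, so that univariate polynomial arithmetic over the domain
    of the lift becomes available. *)
Section GraphField.

Variable G : set (k * A).
Hypothesis HG : lift_graph G.
Hypothesis HGV : forall u, G u -> u.1 != 0 -> exists2 v, G v & v * u = 1.

Definition graph_pred (u : k * A) : bool := `[< G u >].

Lemma graph_subring : subring_closed graph_pred.
Proof.
split; first by apply/asboolP/(lift_graph1 HG).
  by move=> u v /asboolP Gu /asboolP Gv; apply/asboolP/(lift_graphB HG).
by move=> u v /asboolP Gu /asboolP Gv; apply/asboolP/(lift_graphM HG).
Qed.

HB.instance Definition _ :=
  GRing.isSubringClosed.Build (k * A)%type graph_pred graph_subring.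

Definition graph_ring := {u : k * A | graph_pred u}.

HB.instance Definition _ := [isSub of graph_ring for @sval _ _].
HB.instance Definition _ := [Choice of graph_ring by <:].
HB.instance Definition _ := [SubChoice_isSubComNzRing of graph_ring by <:].

Lemma graph_ring_inv (l : graph_ring) : exists l', l != 0 -> l' * l = 1.
Proof.
have [l0|l0] := eqVneq l 0; first by exists 0.
have Gl : G (val l) by apply/asboolP/(valP l).
have [|v Gv vl] := HGV Gl.
  apply: contra_neq l0 => l1; apply: val_inj; rewrite rmorph0.
  by apply: injective_projections => //; apply: lift_graph_functional Gl l1.
have Pv : graph_pred v by apply/asboolP.
exists (Sub v Pv) => _; by apply: val_inj.
Qed.

Lemma lift_graph_field :
  exists (L : fieldType) (j : {rmorphism L -> k}) (g : {rmorphism L -> A}),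
    forall u, G u <-> exists l, u = (j l, g l).
Proof.
have [inv invP] := choice graph_ring_inv.
pose inv' l := if l == 0 then 0 else inv l.
have inv'V l : l != 0 -> inv' l * l = 1.
  by move=> l0; rewrite /inv' (negPf l0) invP.
have inv'0 : inv' 0 = 0 by rewrite /inv' eqxx.
pose L : fieldType :=
  HB.pack graph_ring (GRing.ComNzRing_isField.Build graph_ring inv'V inv'0).
pose j : {rmorphism L -> k} := (fst \o (val : graph_ring -> k * A)).
pose g : {rmorphism L -> A} := (snd \o (val : graph_ring -> k * A)).
exists L, j, g => u; split=> [Gu|[l ->]].
  have Pu : graph_pred u by apply/asboolP.
  by exists (Sub u Pu); rewrite /j /g /=; case: (u).
by rewrite -[(_, _)]surjective_pairing; apply/asboolP/(valP l).
Qed.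

End GraphField.

(** * Maximal partial lifts *)

Definition maximal_lift_graph (G : set (k * A)) :=
  lift_graph G /\ forall G', lift_graph G' -> G `<=` G' -> G' `<=` G.

Lemma exists_maximal_lift_graph (G0 : set (k * A)) :
  lift_graph G0 -> exists2 G, maximal_lift_graph G & G0 `<=` G.
Proof.
move=> HG0; pose P := [set X | lift_graph (X `|` G0)].
have [|X [PX Xmax]] := @Zorn_bigcup _ P.
  (* [G0] is added to every member of the chain, so that the empty chain also
     has a lift graph as its union *)
  move=> F FP Fchain; set U := \bigcup_(_ in _) _.
  have stage u v : (U `|` G0) u -> (U `|` G0) v ->
      exists Y, [/\ lift_graph Y, Y u, Y v & Y `<=` U `|` G0].
    have sub X : F X -> X `|` G0 `<=` U `|` G0.
      by move=> FX; apply: setSU => w Xw; exists X.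
    move=> [[X FX Xu]|G0u] [[Y FY Yv]|G0v].
    - have [XY|YX] := Fchain _ _ FX FY.
        exists (Y `|` G0).
        by split; [exact: FP|left; exact: XY|left|exact: sub].
      exists (X `|` G0).
      by split; [exact: FP|left|left; exact: YX|exact: sub].
    - by exists (X `|` G0); split; [exact: FP|left|right|exact: sub].
    - by exists (Y `|` G0); split; [exact: FP|right|left|exact: sub].
    - by exists G0; split=> //; exact: subsetUr.
  split.
  - by right; exact: lift_graph1.
  - move=> u v Uu Uv; have [Y [HY Yu Yv]] := stage u v Uu Uv.
    by apply; exact: lift_graphB.
  - move=> u v Uu Uv; have [Y [HY Yu Yv]] := stage u v Uu Uv.
    by apply; exact: lift_graphM.
  - move=> u Uu; have [Y [HY Yu _ _]] := stage u u Uu Uu.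
    exact: (lift_graph_lifts HY).
  - move=> u Uu; have [Y [HY Yu _ _]] := stage u u Uu Uu.
    exact: (lift_graph_functional HY).
exists (X `|` G0); last exact: subsetUr.
split=> // G' HG' XG'.
apply: contrapT => nG'; apply: (Xmax G').
  split; first by move=> u Xu; apply: XG'; left.
  by apply: contra_not nG' => G'X u G'u; left; exact: G'X.
have G0G' : G0 `<=` G' by move=> u G0u; apply: XG'; right.
by rewrite /P /= (_ : _ `|` _ = G') //; apply/setUidPl.
Qed.

(** A lift extends to the fractions [w = u / v] of its domain because the value
    at a nonzero [v] is a unit of [A]. *)
Lemma maximal_lift_graphV (G : set (k * A)) : maximal_lift_graph G ->
  forall u, G u -> u.1 != 0 -> exists2 v, G v & v * u = 1.
Proof.
move=> [HG Gmax].
have G1 := lift_graph1 HG; have GM := lift_graphM HG.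
pose G' := [set w : k * A | exists v, [/\ G v, v.1 != 0 & G (w * v)]].
have HG' : lift_graph G'.
  split.
  - by exists 1; rewrite mulr1 oner_neq0.
  - move=> w w' [v [Gv v0 Gwv]] [v' [Gv' v'0 Gwv']].
    exists (v * v'); split; [exact: GM|by rewrite mulf_neq0|].
    have -> : (w - w') * (v * v') = w * v * v' - w' * v' * v by ring.
    by apply: lift_graphB; first exact: HG; apply: GM.
  - move=> w w' [v [Gv v0 Gwv]] [v' [Gv' v'0 Gwv']].
    exists (v * v'); split; [exact: GM|by rewrite mulf_neq0|].
    by rewrite mulrACA; exact: GM.
  - move=> w [v [Gv v0 Gwv]].
    have := lift_graph_lifts HG Gwv; rewrite !rmorphM (lift_graph_lifts HG Gv).
    move/(congr1 ( *%R^~ (h v.1^-1))).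
    by rewrite -!mulrA -!rmorphM divff // rmorph1 !mulr1.
  - move=> w [v [Gv v0 Gwv]] w0.
    have [b bv] := lift_inv (lift_graph_lifts HG Gv) v0.
    have wv0 : w.2 * v.2 = 0.
      by apply: (lift_graph_functional HG Gwv); rewrite /= w0 mul0r.
    by rewrite -[w.2]mulr1 -bv [b * _]mulrC mulrA wv0 mul0r.
have GG' : G `<=` G' by move=> u Gu; exists 1; rewrite mulr1 oner_neq0.
move=> u Gu u0.
have [b bu] := lift_inv (lift_graph_lifts HG Gu) u0.
have uV : (u.1^-1, b) * u = 1.
  by apply: injective_projections; rewrite //= mulVf.
exists (u.1^-1, b) => //; apply: (Gmax G' HG' GG').
by exists u; rewrite uV.
Qed.

Lemma maximal_lift_graph_total (G : set (k * A)) : maximal_lift_graph G ->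
  (forall p (y : k) (b : A), p \in [pchar k] -> q b = h y ->
     G (y ^+ p, b ^+ p)) ->
  forall x, exists a, G (x, a).
Proof.
move=> Gmax frob x; have [HG Gtop] := Gmax.
have [L [j [g GP]]] := lift_graph_field HG (maximal_lift_graphV Gmax).
have lift_g l : q (g l) = h (j l).
  by apply: (lift_graph_lifts HG (u := (j l, g l))); apply/GP; exists l.
have [|a qa aroot] := lift_adjoin lift_g _ x.
  by move=> p y b pk qb; have /GP[l [-> ->]] := frob p y b pk qb; exists l.
exists a.
pose ev (f : {poly L}) : k * A := ((map_poly j f).[x], (map_poly g f).[a]).
apply: (Gtop (range ev)).
- split.
  + by exists 1; rewrite // /ev !rmorph1 !hornerC.
  + move=> _ _ [f _ <-] [f' _ <-]; exists (f - f') => //.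
    by rewrite /ev !rmorphB !hornerD !hornerN.
  + move=> _ _ [f _ <-] [f' _ <-]; exists (f * f') => //.
    by rewrite /ev !rmorphM !hornerM.
  + by move=> _ [f _ <-]; exact: horner_lift.
  + by move=> _ [f _ <-] /= fx; apply/eqP/aroot/eqP.
- by move=> u /GP[l ->]; exists l%:P => //; rewrite /ev !map_polyC !hornerC.
- by exists 'X => //; rewrite /ev !map_polyX !hornerX.
Qed.

(** * Lifts over a perfect field *)

Lemma extend_lift (G0 : set (k * A)) : lift_graph G0 ->
  (forall p (y : k) (b : A), p \in [pchar k] -> q b = h y ->
     G0 (y ^+ p, b ^+ p)) ->
  exists2 g : {rmorphism k -> A},
    (forall u, G0 u -> g u.1 = u.2) & forall x, q (g x) = h x.
Proof.
move=> HG0 frob; have [G Gmax G0G] := exists_maximal_lift_graph HG0.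
have [g gG] := choice (maximal_lift_graph_total Gmax
  (fun p y b pk qb => G0G _ (frob p y b pk qb))).
have [HG _] := Gmax.
have geq u : G u -> g u.1 = u.2.
  by move=> Gu; exact: (lift_graph_eq HG (gG _) Gu).
have gB : zmod_morphism g.
  by move=> x y; exact: geq (lift_graphB HG (gG x) (gG y)).
have gM : monoid_morphism g.
  split; first exact: geq (lift_graph1 HG).
  by move=> x y; exact: geq (lift_graphM HG (gG x) (gG y)).
pose g' : {rmorphism k -> A} := HB.pack g
  (GRing.isZmodMorphism.Build _ _ g gB) (GRing.isMonoidMorphism.Build _ _ g gM).
exists g' => [u /G0G|x]; first exact: geq.
exact: (lift_graph_lifts HG (gG x)).
Qed.

Lemma graph_of_lift (F : fieldType) (iota : {rmorphism F -> k})
    (f : {rmorphism F -> A}) :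
  (forall c, q (f c) = h (iota c)) ->
  lift_graph (range (fun c => (iota c, f c))).
Proof.
move=> qf; split.
- by exists 1; rewrite ?rmorph1.
- by move=> _ _ [c _ <-] [d _ <-]; exists (c - d); rewrite ?rmorphB.
- by move=> _ _ [c _ <-] [d _ <-]; exists (c * d); rewrite ?rmorphM.
- by move=> _ [c _ <-] /=.
- by move=> _ [c _ <-] /= /eqP; rewrite fmorph_eq0 => /eqP ->; rewrite rmorph0.
Qed.

(** The [p]-th power of a lift of [h x] does not depend on the lift, as the
    Frobenius of [A] kills the kernel of [q]; hence [x^p |-> a^p] is a lift on
    the [p]-th powers of [k], although [x |-> a] is no map at all. *)
Lemma frobenius_lift_graph p : p \in [pchar k] -> p \in [pchar A] ->
  lift_graph [set (w.1 ^+ p, w.2 ^+ p) | w in [set w : k * A | q w.2 = h w.1]].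
Proof.
move=> pk pA; split.
- by exists 1; rewrite /= ?rmorph1 ?expr1n.
- move=> _ _ [u /= qu <-] [v /= qv <-]; exists (u - v) => /=.
    by rewrite !rmorphB qu qv.
  by rewrite -!(pFrobenius_autE pk) -!(pFrobenius_autE pA) !rmorphB.
- move=> _ _ [u /= qu <-] [v /= qv <-]; exists (u * v) => /=.
    by rewrite !rmorphM qu qv.
  by rewrite !exprMn.
- by move=> _ [u /= qu <-] /=; rewrite !rmorphXn qu.
- move=> _ [u /= qu <-] /= /eqP; rewrite expf_eq0 => /andP[_ /eqP u0].
  have p1 := prime_gt1 (pcharf_prime pk).
  have q0 : q u.2 = 0 by rewrite qu u0 rmorph0.
  by rewrite -(subnK p1) exprD expr2 (ker_sqr0 q0 q0) mulr0.
Qed.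

(** In characteristic [p], the lift on [k^p] agrees with [f] on [F] because
    every [c] in [F] is some [d^p], and [f d] is a lift of [h (iota d)]. *)
Lemma lift_of_perfect (F : fieldType) (iota : {rmorphism F -> k})
    (f : {rmorphism F -> A}) :
  perfect_field F -> (forall c, q (f c) = h (iota c)) ->
  exists2 g : {rmorphism k -> A},
    (forall c, g (iota c) = f c) & forall x, q (g x) = h x.
Proof.
move=> [F0|[p pF Froot]] qf.
  have [|g gG qg] := extend_lift (graph_of_lift qf).
    (* in characteristic 0 there are no [p]-th powers to handle *)
    by move=> p y b; rewrite (fmorph_pchar iota) F0.
  by exists g => // c; apply: (gG (iota c, f c)); exists c.
have pk : p \in [pchar k] by rewrite (fmorph_pchar iota).
have pA : p \in [pchar A] by exact: rmorph_pchar f _ pF.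
have [|g gG qg] := extend_lift (frobenius_lift_graph pk pA).
  move=> p' y b + qb; rewrite (pcharf_eq pk) => /eqP ->.
  by exists (y, b).
exists g => // c; have [d <-] := Froot c.
by apply: (gG (_, _)); exists (iota d, f d); rewrite /= ?rmorphXn.
Qed.

End Lifting.

Theorem lemma1p4 (F k : fieldType) (iota : {rmorphism F -> k}) :
  perfect_field F -> formally_smooth iota.
Proof.
move=> Fperfect A I I2 h h' hh'.
have [A0|A1] := eqVneq (1 : A) 0.
  (* in the zero ring the constant map is the lift *)
  have triv (a : A) : a = 0 by rewrite -[a]mulr1 A0 mulr0.
  pose g0 (x : k) : A := 0.
  have gB : zmod_morphism g0 by move=> x y; rewrite [LHS]triv [RHS]triv.
  have gM : monoid_morphism g0.
    by split=> [|x y]; rewrite [LHS]triv [RHS]triv.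
  pose g : {rmorphism k -> A} := HB.pack g0
    (GRing.isZmodMorphism.Build _ _ g0 gB)
    (GRing.isMonoidMorphism.Build _ _ g0 gM).
  exists g; split=> x; first by rewrite [LHS]triv [RHS]triv.
  have [a <-] := quotient_map_surj (h' x).
  exact/(congr1 (quotient_map I))/esym/triv.
(* [A] is opened into its operations so that the nonzero ring [A'] built on
   them is convertible to [A] as a ring, and [I] is still one of its ideals *)
case: A I I2 h h' hh' A1 => T [? ? ? ? ? ? ? ? ? ? ?].
set A := GRing.ComPzRing.Pack _ => I I2 h h' hh' A1.
pose A' : comNzRingType :=
  HB.pack T A (GRing.PzSemiRing_isNonZero.Build A A1).
have ker a : quotient_map I a = 0 -> a \in I.
  by rewrite -quotient_map_eq0 => ->.
have [||g gf qg] := @lift_of_perfect k A' (quotient_ring I)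
  (quotient_map I : {rmorphism A -> _}) h'
  (@quotient_map_surj _ I) _ F iota h Fperfect.
- by move=> a b /ker aI /ker bI; exact: I2.
- by move=> c; exact: hh'.
by exists g.
Qed.
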